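(* Let $D$ be a U-type $(n,m,s^p)$ design. Let $$A_0=\sum_{i=0}^p\frac{\omega(i)}{s^i},\quad A_1=\sum_{i=0}^p\frac{\omega(i)}{s^{2i}},\quad B=\sum_{i=0}^p\frac{\omega(i)^2}{s^{3i}},\quad C=\sum_{0\le i<j\le p}\frac{\omega(i)\omega(j)}{s^{i+2j}},$$ and $A_0^{(\ell)}=\sum_{i=0}^{\ell}\omega(i)/s^i$ for $\ell=0,\ldots,p-1$. Then $G_D^{\rm LB}\le G_D\le G_D^{\rm UB}$, where $$G_D=\sum_{a=1}^n\sum_{b=1}^n d_{ab}^2,\qquad G_D^{\rm LB}=\frac{n^3m^2}{n-1}(A_0-A_1)^2,\qquad G_D^{\rm UB}=n^2m^2\sum_{\ell=0}^{p-1}\frac{s-1}{s^{\ell+1}}\bigl(A_0-A_0^{(\ell)}\bigr)^2.$$ Moreover, the lower bound $G_D^{\rm LB}$ is attained (i.e. $G_D=G_D^{\rm LB}$) if and only if $d_{ab}=\bar d$ for all $1\le a<b\le n$, where $$\bar d=\frac{nm}{n-1}(A_0-A_1).$$ The upper bound $G_D^{\rm UB}$ is attained by any U-type $(n,m,s^p)$ design whose $m$ columns are identical copies of a balanced column on $\mathbb{Z}_{s^p}$, i.e., a column in which each of the $s^p$ levels appears $n/s^p$ times. Consequently, $\Phi_{\rm SD}^{\rm LB}\le\Phi_{\rm SD}(D)\le\Phi_{\rm SD}^{\rm UB}$, where $$\Phi_{\rm SD}^{\rm LB}=\frac{m}{(n-1)(m-1)}A_0^2-\frac{2m}{(n-1)(m-1)}A_0A_1+\frac{n+m-1}{(n-1)(m-1)}A_1^2-\frac{1}{m-1}B-\frac{2}{m-1}C$$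 and $$\Phi_{\rm SD}^{\rm UB}=\frac{m}{(m-1)s^p}A_0^2-A_1^2+\frac{m}{m-1}\sum_{\ell=0}^{p-1}\frac{s-1}{s^{\ell+1}}\bigl(A_0^{(\ell)}\bigr)^2-\frac{1}{m-1}B-\frac{2}{m-1}C.$$
   Context: Fix integers $s\ge 2$, $p\ge 1$, $m\ge 2$, and a weight function $\omega:\{0,1,\ldots,p\}\to[0,\infty)$ with $\omega(i)>0$ for at least one $i$. Designs. For a positive integer $q$, $\mathbb{Z}_q=\{0,1,\ldots,q-1\}$. An $(n,m,s^p)$ design is an $n\times m$ matrix $D=(x_{ik})$ with entries in $\mathbb{Z}_{s^p}$ (rows are runs, columns are factors; rows may repeat). It is U-type if in every column each of the $s^p$ levels appears equally often. $D$ is identified with the $n$ points (counted with multiplicity) $\mathbf z_i=(z_{i1},\ldots,z_{im})\in[0,1)^m$, $z_{ik}=(2x_{ik}+1)/(2s^p)$. Stratified $L_2$-discrepancy. For $u\in\{0,\ldots,p\}$ and $x\in[0,1)$ let $R_u(x)=\big[\lfloor s^ux\rfloor/s^u,\ \lfloor s^ux\rfloor/s^u+1/s^u\big)$. For a collection $P$ of $n$ points of $[0,1)^r$ (with multiplicity), $\mathbf u=(u_1,\ldots,u_r)\in\{0,\ldots,p\}^r$ and $\mathbf x\in[0,1)^r$, let $R_{\mathbf u}(\mathbf x)=R_{u_1}(x_1)\times\cdots\times R_{u_r}(x_r)$, which has volume $s^{-\sum_j u_j}$, and let $\omega(\mathbf u)=\prod_{j=1}^r\omega(u_j)$. The squared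 stratified $L_2$-discrepancy is $$\mathrm{SD}^2(P)=\sum_{\mathbf u\in\{0,\ldots,p\}^r}\omega(\mathbf u)\int_{[0,1)^r}\left|s^{-\sum_j u_j}-\frac{|P\cap R_{\mathbf u}(\mathbf x)|}{n}\right|^2 d\mathbf x .$$ For a design, $\mathrm{SD}^2$ denotes $\mathrm{SD}^2$ of the associated points. Uniform projection criterion. $$\Phi_{\rm SD}(D)=\frac{2}{m(m-1)}\sum_{u\subset\{1,\ldots,m\},\,|u|=2}\mathrm{SD}^2(D_u),$$ where $D_u$ is the $n\times 2$ subdesign of $D$ formed by the columns indexed by $u$. Weighted hierarchical distance. For $x,y\in[0,1)$ and $i=0,\ldots,p$ let $\delta_i(x,y)=1$ if $\lfloor s^ix\rfloor=\lfloor s^iy\rfloor$ and $0$ otherwise. For $a,b\in\{1,\ldots,n\}$, $$d_{ab}=\sum_{k=1}^m\sum_{i=0}^p\frac{\omega(i)}{s^i}\bigl\{1-\delta_i(z_{ak},z_{bk})\bigr\}.$$ *)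

(* Defs.v *)
From HB Require Import structures.
From mathcomp Require Import all_boot all_order all_algebra.
From mathcomp Require Import all_classical all_reals all_analysis.
Set Implicit Arguments.
Unset Strict Implicit.
Unset Printing Implicit Defensive.
Import Order.TTheory GRing.Theory Num.Theory.
Import numFieldNormedType.Exports.
Local Open Scope ring_scope.

(* The Lebesgue measure on R^r, carried by r.-tuple R: the Dirac mass at the
   unique point of R^0, and then the image of the product of the Lebesgue
   measure on R with the one on R^r under (x, t) |-> x :: t. *)

Section ConsMeasure.
Local Open Scope classical_set_scope.
Local Open Scope ereal_scope.
Context d (T : measurableType d) (R : realType) (r : nat).

Definition tcons (xt : T * r.-tuple T) : r.+1.-tuple T :=
  [the r.+1.-tuple T of xt.1 :: xt.2].

Lemma measurable_tcons : measurable_fun [set: T * r.-tuple T] tcons.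
Proof. exact: measurable_cons. Qed.

Definition tuncons (t : r.+1.-tuple T) : T * r.-tuple T :=
  (thead t, [tuple of behead t]).

Lemma tconsK : cancel tcons tuncons.
Proof. by move=> [x t]; rewrite /tuncons; congr (_, _); exact: val_inj. Qed.

Lemma measurable_tuncons : measurable_fun [set: r.+1.-tuple T] tuncons.
Proof.
apply/measurable_fun_pairP; split; first exact: (measurable_tnth ord0).
exact: measurable_behead.
Qed.

Variable m1 : {sigma_finite_measure set T -> \bar R}.
Variable m2 : {sigma_finite_measure set (r.-tuple T) -> \bar R}.

Definition cons_measure : set (r.+1.-tuple T) -> \bar R :=
  pushforward (m1 \x m2) tcons.

Let cons_measure0 : cons_measure set0 = 0.
Proof. by rewrite /cons_measure /pushforward preimage_set0 measure0. Qed.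

Let cons_measure_ge0 A : 0 <= cons_measure A.
Proof. by rewrite /cons_measure /pushforward; exact: measure_ge0. Qed.

Let cons_measure_sigma_additive : semi_sigma_additive cons_measure.
Proof.
move=> F mF tF mUF; rewrite /cons_measure /pushforward preimage_bigcup.
have mpre A : measurable A -> measurable (tcons @^-1` A).
  by move=> mA; rewrite -[X in measurable X]setTI; exact: measurable_tcons.
apply: measure_semi_sigma_additive; first by move=> k; exact: mpre.
- apply/trivIsetP => /= i j _ _ ij; rewrite -preimage_setI.
  by move/trivIsetP : tF => /(_ _ _ _ _ ij) ->//; rewrite preimage_set0.
- by rewrite -preimage_bigcup; exact: mpre.
Qed.

HB.instance Definition _ := isMeasure.Build _ _ _ cons_measure
  cons_measure0 cons_measure_ge0 cons_measure_sigma_additive.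

Let cons_measure_sigma_finite : sigma_finite [set: r.+1.-tuple T] cons_measure.
Proof.
have /sigma_finiteP[F [TF ndF Foo]] := sigma_finiteT m1.
have /sigma_finiteP[H [TH ndH Hoo]] := sigma_finiteT m2.
exists (fun k => tuncons @^-1` (F k `*` H k)).
  apply/seteqP; split=> // t _.
  have [k1 _ Fk1] : (\bigcup_k F k) (tuncons t).1 by rewrite -TF.
  have [k2 _ Hk2] : (\bigcup_k H k) (tuncons t).2 by rewrite -TH.
  exists (maxn k1 k2) => //; split.
  - by move: Fk1; exact/subsetPset/ndF/leq_maxl.
  - by move: Hk2; exact/subsetPset/ndH/leq_maxr.
move=> k; have [mFk Fk] := Foo k; have [mHk Hk] := Hoo k; split.
  rewrite -[X in measurable X]setTI; apply: measurable_tuncons => //.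
  exact: measurableX.
rewrite /cons_measure /pushforward -comp_preimage.
rewrite (_ : tuncons \o tcons = id); last by apply/funext => x /=; rewrite tconsK.
by rewrite preimage_id product_measure1E// lte_mul_pinfty// ge0_fin_numE.
Qed.

HB.instance Definition _ :=
  Measure_isSigmaFinite.Build _ _ _ cons_measure cons_measure_sigma_finite.

End ConsMeasure.

Fixpoint lebesgue_tuple (R : realType) (r : nat) :
    {sigma_finite_measure set (r.-tuple (measurableTypeR R)) -> \bar R} :=
  match r with
  | 0 => [the {sigma_finite_measure set _ -> \bar R} of
            dirac ([tuple] : 0.-tuple (measurableTypeR R))]
  | r'.+1 => [the {sigma_finite_measure set _ -> \bar R} of
            cons_measure (@lebesgue_measure R) (lebesgue_tuple R r')]
  end.

Section Discrepancy.
Context (R : realType) (s p : nat) (omega : 'I_p.+1 -> R).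

(* Level-u elementary interval R_u(x). *)
Definition elem_itv (u : nat) (x : R) : interval R :=
  let a := (Num.floor (s%:R ^+ u * x))%:~R / s%:R ^+ u in
  `[a, a + 1 / s%:R ^+ u[.

Definition elem_box (r : nat) (u : {ffun 'I_r -> 'I_p.+1}) (x : r.-tuple R) :
    pred (r.-tuple R) :=
  [pred z | [forall j : 'I_r, tnth z j \in elem_itv (u j) (tnth x j)]].

Definition unit_cube (r : nat) : set (r.-tuple (measurableTypeR R)) :=
  [set x | forall j : 'I_r, 0 <= (tnth x j : R) < 1]%classic.

(* A collection of n points of [0,1)^r with multiplicity is a map
   'I_n -> r.-tuple R; points are counted by their index. *)
Definition SD2 (n r : nat) (P : 'I_n -> r.-tuple R) : R :=
  \sum_(u : {ffun 'I_r -> 'I_p.+1})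
    (\prod_(j < r) omega (u j)) *
    \int[lebesgue_tuple R r]_(x in @unit_cube r)
      (`| (s%:R ^+ (\sum_(j < r) u j)%N)^-1
          - #|[pred i : 'I_n | P i \in elem_box u x]|%:R / n%:R | ^+ 2).

End Discrepancy.

Section Designs.
Context (R : realType) (s p : nat).

(* An (n, m, s^p) design is a matrix D : 'M['I_(s ^ p)]_(n, m). *)

Definition balanced (n : nat) (c : 'cV['I_(s ^ p)]_n) : Prop :=
  forall y : 'I_(s ^ p), (#|[pred i | c i ord0 == y]| * s ^ p)%N = n.

Definition U_type (n m : nat) (D : 'M['I_(s ^ p)]_(n, m)) : Prop :=
  forall (k : 'I_m) (y y' : 'I_(s ^ p)),
    #|[pred i | D i k == y]| = #|[pred i | D i k == y']|.

Definition level_pt (x : 'I_(s ^ p)) : R := (2 * x + 1)%:R / (2 * s ^ p)%:R.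

Definition design_pts (n m : nat) (D : 'M['I_(s ^ p)]_(n, m)) :
    'I_n -> m.-tuple R :=
  fun i => [tuple level_pt (D i k) | k < m].

Definition subdesign (n m : nat) (D : 'M['I_(s ^ p)]_(n, m)) (u : {set 'I_m}) :
    'M['I_(s ^ p)]_(n, #|u|) :=
  colsub (fun j : 'I_#|u| => enum_val j) D.

Context (omega : 'I_p.+1 -> R).

Definition PhiSD (n m : nat) (D : 'M['I_(s ^ p)]_(n, m)) : R :=
  2 / (m%:R * (m%:R - 1)) *
  \sum_(u : {set 'I_m} | #|u| == 2%N) SD2 s omega (design_pts (subdesign D u)).

Definition delta (i : nat) (x y : R) : R :=
  (Num.floor (s%:R ^+ i * x) == Num.floor (s%:R ^+ i * y))%:R.

Definition dist (n m : nat) (D : 'M['I_(s ^ p)]_(n, m)) (a b : 'I_n) : R :=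
  \sum_(k < m) \sum_(i < p.+1)
    omega i / s%:R ^+ i *
    (1 - delta i (tnth (design_pts D a) k) (tnth (design_pts D b) k)).

Definition G (n m : nat) (D : 'M['I_(s ^ p)]_(n, m)) : R :=
  \sum_(a < n) \sum_(b < n) dist D a b ^+ 2.

End Designs.

Section Constants.
Context (R : realType) (s p : nat) (omega : 'I_p.+1 -> R).

Definition A0 : R := \sum_(i < p.+1) omega i / s%:R ^+ i.

Definition A1 : R := \sum_(i < p.+1) omega i / s%:R ^+ (2 * i).

Definition B : R := \sum_(i < p.+1) omega i ^+ 2 / s%:R ^+ (3 * i).

Definition C : R :=
  \sum_(i < p.+1) \sum_(j < p.+1 | (i < j)%N)
    omega i * omega j / s%:R ^+ (i + 2 * j).

Definition A0l (l : nat) : R :=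
  \sum_(i < p.+1 | (i <= l)%N) omega i / s%:R ^+ i.

Definition G_LB (n m : nat) : R :=
  n%:R ^+ 3 * m%:R ^+ 2 / (n%:R - 1) * (A0 - A1) ^+ 2.

Definition G_UB (n m : nat) : R :=
  n%:R ^+ 2 * m%:R ^+ 2 *
  \sum_(l < p) (s%:R - 1) / s%:R ^+ l.+1 * (A0 - A0l l) ^+ 2.

Definition dbar (n m : nat) : R := n%:R * m%:R / (n%:R - 1) * (A0 - A1).

Definition Phi_LB (n m : nat) : R :=
  m%:R / ((n%:R - 1) * (m%:R - 1)) * A0 ^+ 2
  - 2 * m%:R / ((n%:R - 1) * (m%:R - 1)) * A0 * A1
  + (n%:R + m%:R - 1) / ((n%:R - 1) * (m%:R - 1)) * A1 ^+ 2
  - 1 / (m%:R - 1) * B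
  - 2 / (m%:R - 1) * C.

Definition Phi_UB (m : nat) : R :=
  m%:R / ((m%:R - 1) * s%:R ^+ p) * A0 ^+ 2
  - A1 ^+ 2
  + m%:R / (m%:R - 1) *
    \sum_(l < p) (s%:R - 1) / s%:R ^+ l.+1 * A0l l ^+ 2
  - 1 / (m%:R - 1) * B
  - 2 / (m%:R - 1) * C.

End Constants.

(* Main.v *)
Require Import Defs.
From mathcomp Require Import all_boot all_order all_algebra.
From mathcomp Require Import all_classical all_reals all_analysis.
From mathcomp Require Import measurable_realfun.
From mathcomp Require Import ring lra zify.
Import Order.TTheory GRing.Theory Num.Theory.
Local Open Scope ring_scope.
Set Implicit Arguments.
Unset Strict Implicit.
Unset Printing Implicit Defensive.

(* For one column let K(x, y) = sum_i omega_i s^-i delta_i(x, y), so that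
   d_ab = sum_k (A0 - K_k(a, b)).  Balance of the columns fixes every row sum of
   (d_ab), and d_aa = 0, hence
     G = G_LB + sum_(a <> b) (d_ab - dbar)^2,
   which gives the lower bound and its equality case.  Cauchy-Schwarz over the m
   columns gives G <= m sum_k sum_(a, b) (A0 - K_k)^2, and the inner double sum
   is the same for all balanced columns; this is the upper bound, with equality
   for identical columns.  Integrating the squared local discrepancy yields
     SD^2(P) = n^-2 sum_(a, b) prod_j K_j(a, b) - A1^r,
   and summing over the pairs of columns makes PhiSD an increasing affine
   function of G. *)

(** * The discrepancy as a kernel sum over pairs of points *)

Section StratifiedDiscrepancy.
Local Open Scope classical_set_scope.

Definition tuple_box (T : Type) (r : nat) (A : 'I_r -> set T) :
    set (r.-tuple T) :=
  [set x | forall j, A j (tnth x j)].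

Section Boxes.
Variable R : realType.
Notation mR := (measurableTypeR R).

Lemma measurable_tuple_box (r : nat) (A : 'I_r -> set mR) :
  (forall j, measurable (A j)) -> measurable (tuple_box A).
Proof.
move=> mA; rewrite (_ : tuple_box A = \big[setI/setT]_(j < r)
    ((fun x : r.-tuple mR => tnth x j) @^-1` A j)).
  apply: bigsetI_measurable => j _; rewrite -[X in measurable X]setTI.
  exact: measurable_tnth.
rewrite -bigcap_seq; apply/seteqP; split => x /= Ax j.
  by move=> _; exact: Ax.
by apply: Ax; rewrite /= mem_index_enum.
Qed.

(** By induction on [r]: the preimage of a box under [tcons] is its first side times the box of the
    remaining sides. *)
Lemma lebesgue_tuple_box (r : nat) (A : 'I_r -> set mR) :
  (forall j, measurable (A j)) ->
  lebesgue_tuple R r (tuple_box A) = (\prod_(j < r) lebesgue_measure (A j))%E.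
Proof.
elim: r A => [|r IH] A mA.
  rewrite big_ord0/= diracE mem_set//; by case.
rewrite big_ord_recl -IH// -product_measure1E//; last first.
  by apply: measurable_tuple_box => j; exact: mA.
rewrite [LHS]/= /cons_measure /pushforward.
congr (_ _); apply/seteqP; split => [[x t]|[x t] [/= Ax At] j].
  move=> /= Axt; split => /= [|j]; first by have := Axt ord0; rewrite tnth0.
  by have := Axt (lift ord0 j); rewrite tnthS.
case: (unliftP ord0 j) => [k ->|->]; rewrite ?tnthS ?tnth0.
  exact: At.
exact: Ax.
Qed.

(** Finiteness of [mu D] makes every indicator integrable on [D], so the real-valued integral
    commutes with the finite sum. *)
Lemma Rintegral_sum_indic d (T : measurableType d)
    (mu : {measure set T -> \bar R}) (D : set T)
    (I : Type) (r : seq I) (c : I -> R) (A : I -> set T) :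
  measurable D -> (mu D < +oo)%E -> (forall i, measurable (A i)) ->
  \int[mu]_(x in D) (\sum_(i <- r) c i * \1_(A i) x) =
  \sum_(i <- r) c i * fine (mu (A i `&` D)).
Proof.
move=> mD Doo mA.
have intA i : mu.-integrable D (EFin \o \1_(A i)).
  apply/integrableP; split; first exact/measurable_EFinP/measurable_indic.
  under eq_integral do rewrite /= ger0_norm//.
  rewrite integral_indic//; apply: le_lt_trans Doo.
  by apply: le_measure; rewrite ?inE//; exact: measurableI.
have intZ i : mu.-integrable D (EFin \o (fun x => c i * \1_(A i) x)).
  have := @integrableZl _ _ _ mu _ mD (c i) _ (intA i).
  by apply: eq_integrable => // x _; rewrite /= EFinM.
elim: r => [|i r IH].
  under eq_Rintegral do rewrite big_nil.
  by rewrite big_nil Rintegral_cst// mul0r.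
under eq_Rintegral do rewrite big_cons.
rewrite big_cons RintegralD//; last first.
  have := @integrable_sum _ _ _ mu D mD _ r xpredT _ (fun i _ => intZ i).
  by apply: eq_integrable => // x _; rewrite /= sumEFin.
by rewrite IH RintegralZl// /Rintegral integral_indic.
Qed.

Lemma Rintegral_sqr_sum_indic d (T : measurableType d)
    (mu : {measure set T -> \bar R}) (D : set T)
    (I : Type) (r : seq I) (c : I -> R) (A : I -> set T) :
  measurable D -> (mu D < +oo)%E -> (forall i, measurable (A i)) ->
  \int[mu]_(x in D) ((\sum_(i <- r) c i * \1_(A i) x) ^+ 2) =
  \sum_(i <- r) \sum_(j <- r) c i * c j * fine (mu (A i `&` A j `&` D)).
Proof.
move=> mD Doo mA.
pose r2 := [seq (i, j) | i <- r, j <- r].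
transitivity (\int[mu]_(x in D)
    (\sum_(ij <- r2) (c ij.1 * c ij.2) * \1_(A ij.1 `&` A ij.2) x)).
  apply: eq_Rintegral => x _; rewrite big_allpairs/= expr2 mulr_suml.
  apply: eq_bigr => i _; rewrite mulr_sumr; apply: eq_bigr => j _.
  by rewrite indicI/= mulrACA.
rewrite Rintegral_sum_indic// => [|ij]; last exact: measurableI.
by rewrite big_allpairs.
Qed.

End Boxes.

Section Stratified.
Variables (R : realType) (s p : nat).
Hypothesis s_gt0 : (0 < s)%N.
Notation mR := (measurableTypeR R).

Let su_gt0 u : 0 < s%:R ^+ u :> R. Proof. by rewrite exprn_gt0// ltr0n. Qed.

(** An elementary interval is a fibre of [floor (s^u * _)]. Hence the cells of one level partition
    the line, and membership is symmetric in the two points. *)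
Lemma mem_elem_itv (u : nat) (x y : R) :
  (y \in elem_itv s u x) =
  (Num.floor (s%:R ^+ u * y) == Num.floor (s%:R ^+ u * x)).
Proof.
rewrite in_itv/= -mulrDl ler_pdivrMr// ltr_pdivlMr// (mulrC y).
apply/idP/eqP => [yx|<-]; last first.
  by have := floor_itv (s%:R ^+ u * y); rewrite intrD.
by apply: floor_def; rewrite intrD.
Qed.

Lemma elem_itv_sub (u : nat) (x : R) : 0 <= x < 1 ->
  [set` elem_itv s u x] `<=` `[0, 1[.
Proof.
move=> /andP[x0 x1] y /=; rewrite mem_elem_itv => /eqP yx.
have := floor_itv (s%:R ^+ u * y); rewrite yx => /andP[ky yk].
have k_ge0 : 0 <= Num.floor (s%:R ^+ u * x).
  by rewrite floor_ge_int mulr_ge0// ltW.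
have k_lt : Num.floor (s%:R ^+ u * x) + 1 <= (s ^ u)%N%:Z.
  rewrite -ltzD1 ltrD2r floor_lt_int -pmulrn natrX.
  by rewrite -[ltRHS]mulr1 ltr_pM2l.
rewrite /= in_itv/= -(pmulr_rge0 _ (su_gt0 u)) -(ltr_pM2l (su_gt0 u)) mulr1.
rewrite (le_trans _ ky) ?ler0z//= (lt_le_trans yk)//.
by rewrite -[leRHS]natrX [leRHS]pmulrn ler_int.
Qed.

(** Two cells of the same level are disjoint or equal; in the latter case the common cell lies in
    the unit interval and has length [s^-u]. *)
Lemma lebesgue_elem_itvI (u : nat) (x y : R) : 0 <= x < 1 ->
  lebesgue_measure ([set` elem_itv s u x] `&` [set` elem_itv s u y] `&`
                    `[0, 1[ : set mR) =
  (delta s u x y / s%:R ^+ u)%:E.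
Proof.
move=> x01; rewrite /delta; case: eqP => [xy|xy]; last first.
  rewrite (_ : _ `&` _ = set0) ?measure0 ?mul0r//.
  apply/seteqP; split => z //= [[]]; rewrite !mem_elem_itv => /eqP zx /eqP zy.
  by case: xy; rewrite -zx.
rewrite (_ : _ `&` _ = [set` elem_itv s u x]); last first.
  apply/seteqP; split => z /=; first by case=> -[].
  move=> zx; split; last exact: elem_itv_sub zx.
  by split => //; move: zx; rewrite !mem_elem_itv xy.
rewrite lebesgue_measure_itv/= lte_fin ltrDl divr_gt0// -EFinB; congr (_%:E).
by rewrite addrC addKr.
Qed.

Variable omega : 'I_p.+1 -> R.

(** For fixed [u] the local discrepancy is a constant minus a multiple of the sum of the indicators
    of the boxes around the points. Its square integrates to measures of intersections of boxes,
    which factor over coordinates; distributivity then turns the sum over [u] into a product of sums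
    over levels. *)
Lemma SD2E (n r : nat) (P : 'I_n -> r.-tuple R) : (0 < n)%N ->
  (forall a j, 0 <= tnth (P a) j < 1) ->
  SD2 s omega P =
  (\sum_(a < n) \sum_(b < n) \prod_(j < r) \sum_(i < p.+1)
     omega i / s%:R ^+ i * delta s i (tnth (P a) j) (tnth (P b) j)) / n%:R ^+ 2
  - A1 s omega ^+ r.
Proof.
move=> n0 P01.
have nR0 : n%:R != 0 :> R by rewrite pnatr_eq0 -lt0n.
have cubeE : @unit_cube R r = tuple_box (fun=> `[0, 1[ : set mR).
  by apply/seteqP; split => x /= x01 j; have := x01 j; rewrite /= in_itv.
(* [v u] is the volume of a level-[u] box, and [w u a b] the measure of the intersection of the
   boxes around [P a] and [P b]. *)
pose v (u : {ffun 'I_r -> 'I_p.+1}) : R := \prod_(j < r) (s%:R ^+ u j)^-1.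
pose w (u : {ffun 'I_r -> 'I_p.+1}) a b : R :=
  \prod_(j < r) (delta s (u j) (tnth (P a) j) (tnth (P b) j) / s%:R ^+ u j).
have itvE (u : {ffun 'I_r -> 'I_p.+1}) :
    \int[lebesgue_tuple R r]_(x in @unit_cube R r)
      (`| (s%:R ^+ (\sum_(j < r) u j)%N)^-1
          - #|[pred i : 'I_n | P i \in elem_box s u x]|%:R / n%:R | ^+ 2) =
    (\sum_(a < n) \sum_(b < n) w u a b) / n%:R ^+ 2 - v u ^+ 2.
  pose mu : {measure set (r.-tuple mR) -> \bar R} := lebesgue_tuple R r.
  have muE B : (forall j, measurable (B j)) ->
      mu (tuple_box B) = (\prod_(j < r) lebesgue_measure (B j))%E.
    exact: lebesgue_tuple_box.
  pose A a : set (r.-tuple mR) := 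
    tuple_box (fun j => [set` elem_itv s (u j) (tnth (P a) j)] : set mR).
  have mA a : measurable (A a).
    by apply: measurable_tuple_box => j; exact: measurable_itv.
  have mcube : measurable (@unit_cube R r).
    by rewrite cubeE; apply: measurable_tuple_box => j; exact: measurable_itv.
  have cube1 : mu (@unit_cube R r) = 1%E.
    rewrite cubeE muE => [|j]; last exact: measurable_itv.
    rewrite big1// => j _; rewrite lebesgue_measure_itv/= lte_fin ltr01.
    by rewrite -EFinB subr0.
  have AA a b : fine (mu (A a `&` A b `&` @unit_cube R r)) = w u a b.
    rewrite (_ : _ `&` _ = tuple_box (fun j =>
        [set` elem_itv s (u j) (tnth (P a) j)] `&`
        [set` elem_itv s (u j) (tnth (P b) j)] `&` `[0, 1[ : set mR)).
      rewrite muE => [|j]; last first.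
        by apply: measurableI; [apply: measurableI|]; exact: measurable_itv.
      under eq_bigr do rewrite lebesgue_elem_itvI//.
      by rewrite prodEFin.
    rewrite cubeE; apply/seteqP; split => x /=.
      move=> [[Ax Bx] x01] j; split; last exact: x01.
      by split; [exact: Ax|exact: Bx].
    by move=> H; split; [split|] => j; have [[? ?] ?] := H j.
  have waa a : w u a a = v u.
    by apply: eq_bigr => j _; rewrite /delta eqxx mul1r.
  (* The index [None] carries the volume term, as a constant on [setT]. *)
  pose rr : seq (option 'I_n) := None :: [seq Some a | a <- index_enum 'I_n].
  pose c (o : option 'I_n) : R := if o is Some _ then - n%:R^-1 else v u.
  pose S (o : option 'I_n) := if o is Some a then A a else setT.
  transitivity (\int[mu]_(x in @unit_cube R r)
     ((\sum_(o <- rr) c o * \1_(S o) x) ^+ 2)).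
    apply: eq_Rintegral => x _; rewrite -normrX ger0_norm ?sqr_ge0//.
    rewrite big_cons big_map/= indicT mulr1 -mulr_sumr; congr ((_ + _) ^+ 2).
      by rewrite /v prodfV -expr_sum.
    rewrite mulrC mulNr; congr (- (_ * _)).
    rewrite -sum1_card natr_sum big_mkcond; apply: eq_bigr => a _.
    (* The box around [x] contains [P a] exactly when the box around [P a] contains [x]. *)
    rewrite indicE inE /=; have -> : (x \in A a) =
        [forall j, tnth (P a) j \in elem_itv s (u j) (tnth x j)].
      apply/idP/forallP => [|H]; rewrite inE.
        by move=> Ax j; have := Ax j; rewrite /= !mem_elem_itv eq_sym.
      by move=> j; have := H j; rewrite /= !mem_elem_itv eq_sym.
    by rewrite [X in if X then _ else _]inE/=; case: [forall j, _].
  rewrite Rintegral_sqr_sum_indic//; last first.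
  - by case=> [a|]; [exact: mA|exact: measurableT].
  - by rewrite cube1 ltry.
  rewrite /rr !big_cons !big_map/= !setTI cube1 mulr1.
  have Sw a : fine (mu (A a `&` @unit_cube R r)) = v u.
    by rewrite -{1}(setIid (A a)) AA waa.
  under eq_bigr do rewrite setTI Sw.
  under [X in _ + X]eq_bigr do rewrite big_cons big_map setIT Sw.
  under [X in _ + X]eq_bigr do under eq_bigr do rewrite AA.
  rewrite big_split/= !sumr_const card_ord addrA [RHS]addrC; congr (_ + _).
    (* The constant term gives [v u ^+ 2] and each of the two families of cross terms gives its
       opposite, which leaves [- v u ^+ 2]. *)
    by rewrite -(mulr_natr (v u * _ * _)) -(mulr_natr (- _ * _ * _))/=; field.
  rewrite mulr_suml; apply: eq_bigr => a _.
  rewrite mulr_suml; apply: eq_bigr => b _.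
  by rewrite mulrNN -invfM -expr2 mulrC.
rewrite /SD2; under eq_bigr do rewrite itvE mulrBr.
rewrite sumrB; congr (_ - _).
  under eq_bigr do rewrite mulrA.
  rewrite -mulr_suml; congr (_ / _).
  under eq_bigr do rewrite mulr_sumr.
  rewrite exchange_big; apply: eq_bigr => a _.
  under eq_bigr do rewrite mulr_sumr.
  rewrite exchange_big; apply: eq_bigr => b _.
  rewrite bigA_distr_bigA; apply: eq_bigr => u _.
  rewrite -big_split; apply: eq_bigr => j _ /=.
  by rewrite mulrCA mulrC.
transitivity (\prod_(j < r) A1 s omega); last by rewrite prodr_const card_ord.
rewrite bigA_distr_bigA; apply: eq_bigr => u _.
rewrite /v -prodrXl -big_split; apply: eq_bigr => j _ /=.
by rewrite mulnC exprM exprVn.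
Qed.

End Stratified.

End StratifiedDiscrepancy.

(** * Base-[s] digits of the levels, and sums over a balanced column *)

Section Levels.
Variables (R : realType) (s p : nat).
Hypothesis s_gt1 : (1 < s)%N.

Let s_gt0 : (0 < s)%N. Proof. exact: ltnW. Qed.

Let sR_neq0 : s%:R != 0 :> R. Proof. by rewrite pnatr_eq0 -lt0n. Qed.

(** With [q = s^(p-i)], the scaled midpoint is [(2x+1)/(2q)]; the half step added to [x] never
    reaches the next multiple of [q]. The quotient consists of the [i] leading base-[s] digits of
    [x]. *)
Lemma floor_level_pt (i : nat) (x : 'I_(s ^ p)) : (i <= p)%N ->
  Num.floor (s%:R ^+ i * level_pt R x) = (x %/ s ^ (p - i))%N :> int.
Proof.
move=> ip; apply: floor_def.
have Ep : (s ^ p = s ^ i * s ^ (p - i))%N by rewrite -expnD subnKC.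
set q := (s ^ (p - i))%N in Ep *.
have q0 : (0 < q)%N by rewrite expn_gt0 s_gt0.
have -> : s%:R ^+ i * level_pt R x = (2 * x + 1)%:R / (2 * q)%:R.
  rewrite /level_pt; set v := (2 * x + 1)%:R.
  rewrite Ep 3!natrM natrX; field.
  by rewrite pnatr_eq0 -lt0n q0 expf_neq0.
rewrite -PoszD -!pmulrn ler_pdivlMr ?ltr_pdivrMr ?ltr0n ?muln_gt0 ?q0//.
rewrite -!natrM ler_nat ltr_nat addn1.
have := divn_eq x q; have := ltn_pmod x q0.
move: (x %/ q)%N (x %% q)%N => a b; nia.
Qed.

Lemma delta_level_pt (i : nat) (x y : 'I_(s ^ p)) : (i <= p)%N ->
  delta s i (level_pt R x) (level_pt R y) =
  (x %/ s ^ (p - i) == y %/ s ^ (p - i))%N%:R.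
Proof. by move=> ip; rewrite /delta !floor_level_pt. Qed.

(** The cells are nested: sharing a level-[j] cell forces sharing the coarser level-[i] cell. *)
Lemma delta_level_ptM (i j : nat) (x y : 'I_(s ^ p)) : (i <= j <= p)%N ->
  delta s i (level_pt R x) (level_pt R y) *
  delta s j (level_pt R x) (level_pt R y) =
  delta s j (level_pt R x) (level_pt R y).
Proof.
move=> /andP[ij jp]; rewrite !delta_level_pt ?(leq_trans ij)//.
have [xy|] := eqVneq (x %/ s ^ (p - j))%N (y %/ s ^ (p - j))%N; last first.
  by rewrite mulr0.
rewrite mulr1 (_ : p - i = p - j + (j - i))%N; last by lia.
by rewrite expnD !divnMA xy eqxx.
Qed.

Lemma delta0_level_pt (x y : 'I_(s ^ p)) :
  delta s 0 (level_pt R x) (level_pt R y) = 1.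
Proof. by rewrite delta_level_pt// subn0 !divn_small ?eqxx. Qed.

(** The block is the image of [j |-> (x %/ q) * q + j] for [j < q], which stays below [s ^ p]
    because [x %/ q < s ^ i]. *)
Lemma card_level_block (i : nat) (x : 'I_(s ^ p)) : (i <= p)%N ->
  #|[pred y : 'I_(s ^ p) | x %/ s ^ (p - i) == y %/ s ^ (p - i)]%N| =
  (s ^ (p - i))%N.
Proof.
move=> ip; have Ep : (s ^ p = s ^ i * s ^ (p - i))%N by rewrite -expnD subnKC.
set q := (s ^ (p - i))%N in Ep *.
have q0 : (0 < q)%N by rewrite expn_gt0 s_gt0.
have lt_f (j : 'I_q) : (x %/ q * q + j < s ^ p)%N.
  have : (x < s ^ i * q)%N by rewrite -Ep.
  rewrite -ltn_divLR// => xq; rewrite [X in (_ < X)%N]Ep.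
  have := ltn_ord j; nia.
pose f j := Ordinal (lt_f j).
rewrite -[RHS]card_ord -(@card_imset _ _ f); last first.
  by move=> j k [] /addnI /val_inj.
apply: eq_card => y; rewrite [LHS]inE.
apply/idP/imsetP => [/eqP xy|[j _ ->]]; last first.
  by rewrite /= divnMDl// (@divn_small j) ?addn0.
exists (Ordinal (ltn_pmod y q0)) => //; apply: val_inj => /=.
by rewrite xy -divn_eq.
Qed.

Section Column.
Variables (n : nat) (c : 'I_n -> 'I_(s ^ p)).
Hypothesis bal : forall y, (#|[pred b | c b == y]| * s ^ p)%N = n.

(** The block of [c a] holds [s^(p-i)] levels, and each of them occurs [n / s^p] times in the
    column. *)
Lemma sum_delta_balanced (i : nat) (a : 'I_n) : (i <= p)%N ->
  \sum_(b < n) delta s i (level_pt R (c a)) (level_pt R (c b)) =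
  n%:R / s%:R ^+ i.
Proof.
move=> ip.
under eq_bigr do rewrite delta_level_pt//.
rewrite -natr_sum.
set Q := fun y : 'I_(s ^ p) => (c a %/ s ^ (p - i) == y %/ s ^ (p - i))%N.
have -> : (\sum_(b < n) Q (c b) = #|[pred b | c b == c a]| * s ^ (p - i))%N.
  rewrite -(card_level_block (c a) ip) mulnC -sum_nat_const.
  rewrite (partition_big c predT)//= [RHS]big_mkcond/=; apply: eq_bigr => y _.
  have -> : (\sum_(b < n | c b == y) Q (c b) = Q y * #|[pred b | c b == y]|)%N.
    rewrite mulnC -sum_nat_const; apply: eq_big => [b|b /eqP->]//.
  rewrite inE -/(Q y); case: (Q y); rewrite ?mul1n ?mul0n//.
  (* Both counts times [s ^ p] equal [n], so [y] occurs as often as [c a]. *)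
  move/eqP: (etrans (bal y) (esym (bal (c a)))).
  by rewrite eqn_mul2r expn_eq0 (gtn_eqF s_gt0)/= => /eqP.
have -> : n%:R = #|[pred b | c b == c a]|%:R * s%:R ^+ i * s%:R ^+ (p - i) :> R.
  by rewrite -mulrA -exprD subnKC// -natrX -natrM bal.
rewrite natrM natrX; field.
exact: expf_neq0.
Qed.

End Column.

Variable omega : 'I_p.+1 -> R.

(** The one-column kernel [K] of the overview, taken on levels. *)
Definition proximity (x y : 'I_(s ^ p)) : R :=
  \sum_(i < p.+1) omega i / s%:R ^+ i * delta s i (level_pt R x) (level_pt R y).

Notation A0 := (A0 s omega).
Notation A1 := (A1 s omega).

Lemma dist_coordE (x y : 'I_(s ^ p)) :
  \sum_(i < p.+1) omega i / s%:R ^+ i *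
    (1 - delta s i (level_pt R x) (level_pt R y)) = A0 - proximity x y.
Proof. by rewrite -sumrB; apply: eq_bigr => i _; rewrite mulrBr mulr1. Qed.

(* At most one factor [delta_l - delta_l.+1] is nonzero, the one at the deepest
   level [l] at which [x] and [y] still share a cell. *)
Lemma dist_coord_sqr (x y : 'I_(s ^ p)) :
  (A0 - proximity x y) ^+ 2 =
  \sum_(l < p) (delta s l (level_pt R x) (level_pt R y) -
                delta s l.+1 (level_pt R x) (level_pt R y)) *
               (A0 - A0l s omega l) ^+ 2.
Proof.
set del := fun i => delta s i (level_pt R x) (level_pt R y).
have delM i j : (i <= j <= p)%N -> del i * del j = del j.
  exact: delta_level_ptM.
(* Where the difference is nonzero, [del i] is 1 for [i <= l] and 0 beyond, so the one-column
   distance is the tail of the weights after [l]. *)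
have step (l : 'I_p) : (del l - del l.+1) * (A0 - proximity x y) =
    (del l - del l.+1) * (A0 - A0l s omega l).
  rewrite -dist_coordE [A0l _ _ _]big_mkcond -sumrB !mulr_sumr.
  apply: eq_bigr => i _; rewrite -/(del i).
  have := ltn_ord l; have := ltn_ord i => ip lp.
  case: leqP => il.
    rewrite subrr mulr0.
    rewrite mulrCA; apply/eqP; rewrite mulf_eq0; apply/orP; right; apply/eqP.
    rewrite mulrBr mulr1 mulrBl !(mulrC _ (del i)) !delM ?subrr//; lia.
  rewrite subr0 mulrCA mulrC; congr (_ * _).
  rewrite mulrBr mulr1 mulrBl !delM ?subrr ?subr0//; lia.
(* The differences telescope to [1 - del p], and the distance vanishes when [del p = 1]. *)
have tele : (A0 - proximity x y) = 
    (\sum_(l < p) (del l - del l.+1)) * (A0 - proximity x y).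
  have -> : \sum_(l < p) (del l - del l.+1) = 1 - del p.
    rewrite -(big_mkord xpredT (fun l => del l - del l.+1)).
    rewrite -[LHS]opprK -sumrN; under eq_bigr do rewrite opprB.
    by rewrite telescope_sumr// opprB /del delta0_level_pt.
  rewrite -dist_coordE mulr_sumr; apply: eq_bigr => i _.
  rewrite mulrCA; congr (_ * _); rewrite -/(del i).
  rewrite mulrBl mul1r mulrBr mulr1 (mulrC _ (del i)) delM ?subrr ?subr0//.
  by rewrite -ltnS ltn_ord/= leqnn.
rewrite expr2 {1}tele !mulr_suml; apply: eq_bigr => l _; rewrite -/(del l).
by rewrite step -mulrA (mulrC _ (A0 - proximity x y)) mulrA step -mulrA.
Qed.

Section BalancedColumn.
Variables (n : nat) (c : 'I_n -> 'I_(s ^ p)).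
Hypothesis bal : forall y, (#|[pred b | c b == y]| * s ^ p)%N = n.

Lemma sum_proximity (a : 'I_n) :
  \sum_(b < n) proximity (c a) (c b) = n%:R * A1.
Proof.
rewrite exchange_big/= mulr_sumr; apply: eq_bigr => i _.
rewrite -mulr_sumr sum_delta_balanced ?leq_ord// mul2n -addnn exprD.
by field; rewrite expf_neq0.
Qed.

(** Summing [delta_l - delta_l.+1] over [b] gives [n (s^-l - s^-(l+1))], whatever [a] is; the sum
    over [a] supplies the second factor [n]. *)
Lemma sum_dist_coord_sqr :
  \sum_(a < n) \sum_(b < n) (A0 - proximity (c a) (c b)) ^+ 2 =
  n%:R ^+ 2 *
  \sum_(l < p) (s%:R - 1) / s%:R ^+ l.+1 * (A0 - A0l s omega l) ^+ 2.
Proof.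
rewrite -[n in n%:R ^+ 2]card_ord expr2 -mulrA mulr_natl -sumr_const.
apply: eq_bigr => a _; under eq_bigr do rewrite dist_coord_sqr.
rewrite exchange_big/= mulr_sumr; apply: eq_bigr => l _.
rewrite -mulr_suml sumrB !sum_delta_balanced ?ltn_ord//; last exact: ltnW.
by rewrite card_ord exprS; field; rewrite expf_neq0 ?sR_neq0.
Qed.

(** Nesting collapses [delta_i * delta_j] to the delta of level [max(i, j)], whose row sum is
    [n / s^max(i, j)]. The terms [i = j] form [B], and the two triangles [i < j] and [j < i] give
    [C] each. *)
Lemma sum_proximity_sqr :
  \sum_(a < n) \sum_(b < n) proximity (c a) (c b) ^+ 2 =
  n%:R ^+ 2 * (B s omega + 2 * C s omega).
Proof.
rewrite -[n in n%:R ^+ 2]card_ord expr2 -mulrA mulr_natl -sumr_const.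
apply: eq_bigr => a _; rewrite card_ord.
pose w (i : 'I_p.+1) := omega i / s%:R ^+ i.
have ijp (i j : 'I_p.+1) : (maxn i j <= p)%N.
  by rewrite geq_max !leq_ord.
have -> : \sum_(b < n) proximity (c a) (c b) ^+ 2 =
    \sum_(i < p.+1) \sum_(j < p.+1) n%:R * (w i * w j / s%:R ^+ maxn i j).
  transitivity (\sum_(b < n) \sum_(i < p.+1) \sum_(j < p.+1)
      w i * w j * delta s (maxn i j) (level_pt R (c a)) (level_pt R (c b))).
    apply: eq_bigr => b _; rewrite expr2 mulr_suml; apply: eq_bigr => i _.
    rewrite mulr_sumr; apply: eq_bigr => j _.
    rewrite -/(w i) -/(w j) mulrACA; congr (_ * _).
    have := ijp i j; case: (leqP i j) => ij jp.
      by rewrite delta_level_ptM ?ij.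
    by rewrite mulrC delta_level_ptM ?(ltnW ij).
  rewrite exchange_big/=; apply: eq_bigr => i _.
  rewrite exchange_big/=; apply: eq_bigr => j _.
  by rewrite -mulr_sumr sum_delta_balanced// mulrCA.
have -> : B s omega + 2 * C s omega =
    \sum_(i < p.+1) \sum_(j < p.+1) (w i * w j / s%:R ^+ maxn i j).
  pose F (i j : 'I_p.+1) := w i * w j / s%:R ^+ maxn i j.
  have FC i j : F i j = F j i by rewrite /F maxnC (mulrC (w i)).
  have CE : C s omega = \sum_(i < p.+1) \sum_(j < p.+1 | (i < j)%N) F i j.
    apply: eq_bigr => i _; apply: eq_bigr => j ij.
    rewrite /F /w (maxn_idPr (ltnW ij)) mul2n -addnn !exprD; field.
    by rewrite !expf_neq0.
  have CE' : C s omega = \sum_(i < p.+1) \sum_(j < p.+1 | (j < i)%N) F i j.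
    rewrite CE (exchange_big_dep predT)//=.
    by apply: eq_bigr => i _; apply: eq_bigr => j _; rewrite FC.
  rewrite mulr_natl mulr2n {1}CE CE' /B -!big_split/=; apply: eq_bigr => i _.
  rewrite [RHS](bigID (fun j : 'I_p.+1 => (i < j)%N))/=.
  rewrite [X in _ = _ + X](bigD1 i) ?ltnn//= [RHS]addrCA; congr (_ + (_ + _)).
    rewrite maxnn /w !mulSn mul0n addn0 !exprD; field.
    by rewrite !expf_neq0.
  by apply: eq_bigl => j; rewrite -leqNgt -val_eqE/=; lia.
rewrite mulr_sumr; apply: eq_bigr => i _.
by rewrite mulr_sumr.
Qed.

End BalancedColumn.

End Levels.

(** * Sums over pairs of columns, and Cauchy-Schwarz *)

Section FiniteSums.
Variable R : realType.

(** Off the diagonal, the square of the sum runs over ordered pairs, and every two-element set comes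
    from exactly two of them. *)
Lemma sum_pairs_prod (m : nat) (K : 'I_m -> R) :
  2 * \sum_(u : {set 'I_m} | #|u| == 2%N) \prod_(k in u) K k =
  (\sum_k K k) ^+ 2 - \sum_k K k ^+ 2.
Proof.
have -> : (\sum_k K k) ^+ 2 =
    \sum_k K k ^+ 2 + \sum_(q : 'I_m * 'I_m | q.1 != q.2) K q.1 * K q.2.
  rewrite expr2 mulr_suml -(pair_big_dep xpredT (fun i j => i != j)
    (fun i j => K i * K j)) /= -big_split; apply: eq_bigr => i _.
  rewrite mulr_sumr (bigD1 i)//= -expr2; congr (_ + _).
  by apply: eq_bigl => j; rewrite eq_sym.
rewrite addrC addKr mulr_sumr.
rewrite (partition_big (fun q => [set q.1; q.2]) (fun u => #|u| == 2%N))/=;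
  last first.
  by move=> q; rewrite cards2 => ->.
apply: eq_bigr => u /cards2P[x [y [xy ->]]].
rewrite big_setU1 ?inE//= big_set1.
rewrite (bigD1 (x, y)) ?xy ?eqxx//= (bigD1 (y, x))/=; last first.
  by rewrite finset.setUC eqxx eq_sym xy xpair_eqE negb_and eq_sym xy.
rewrite big1 ?addr0 => [|[i j] /=]; first by ring.
rewrite !xpair_eqE => /andP[/andP[/andP[ij /eqP E] n1] n2].
have := set21 i j; have := set22 i j; rewrite E !inE.
move: n1 n2 ij => /[swap] /[swap].
by do 2 case: eqVneq => //= ?; subst; do ?case: eqVneq => //= ?; subst;
  rewrite ?eqxx.
Qed.

(** Lagrange's identity: twice the gap is the sum of all [(e k - e l) ^+ 2]. *)
Lemma sqr_sum_le (m : nat) (e : 'I_m -> R) :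
  (\sum_k e k) ^+ 2 <= m%:R * \sum_k e k ^+ 2.
Proof.
have : 0 <= \sum_k \sum_l (e k - e l) ^+ 2.
  by apply: sumr_ge0 => k _; apply: sumr_ge0 => l _; exact: sqr_ge0.
have -> : \sum_k \sum_l (e k - e l) ^+ 2 =
    2 * (m%:R * \sum_k e k ^+ 2 - (\sum_k e k) ^+ 2).
  transitivity (\sum_k (m%:R * e k ^+ 2 + (\sum_l e l ^+ 2) 
       - 2 * (e k * \sum_l e l))).
    apply: eq_bigr => k _.
    transitivity (\sum_l (e k ^+ 2 + e l ^+ 2 - 2 * e k * e l)).
      by apply: eq_bigr => l _; ring.
    rewrite sumrB big_split/= sumr_const card_ord -mulr_sumr.
    by rewrite -(mulr_natl (e k ^+ 2)) mulrA.
  rewrite sumrB big_split/= -!mulr_sumr -mulr_suml sumr_const card_ord.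
  by rewrite -(mulr_natl (\sum_l _)); ring.
by rewrite pmulr_rge0// subr_ge0.
Qed.

End FiniteSums.

(** * Telescoping level weights, relating [G_UB] to [Phi_UB] *)

Section Constants.
Variables (R : realType) (s p : nat) (omega : 'I_p.+1 -> R).
Hypothesis s_gt0 : (0 < s)%N.

Let sX_neq0 i : s%:R ^+ i != 0 :> R.
Proof. by rewrite expf_neq0// pnatr_eq0 -lt0n. Qed.

Lemma sum_level_weights (i : nat) : (i <= p)%N ->
  \sum_(l < p | (i <= l)%N) (s%:R - 1) / s%:R ^+ l.+1 =
  (s%:R ^+ i)^-1 - (s%:R ^+ p)^-1 :> R.
Proof.
move=> ip.
rewrite -(big_geq_mkord _ _ xpredT (fun l => (s%:R - 1) / s%:R ^+ l.+1)).
transitivity (\sum_(i <= l < p) (- (s%:R ^+ l.+1)^-1 - (- (s%:R ^+ l)^-1)) : R).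
  apply: eq_bigr => l _; rewrite exprS; field.
  by rewrite sX_neq0 -[s%:R]expr1 sX_neq0.
by rewrite telescope_sumr// opprK addrC.
Qed.

(** After exchanging the sums, [omega i / s^i] is weighted by the telescoped tail [s^-i - s^-p]. *)
Lemma sum_level_weights_A0l :
  \sum_(l < p) (s%:R - 1) / s%:R ^+ l.+1 * A0l s omega l =
  A1 s omega - A0 s omega / s%:R ^+ p.
Proof.
under eq_bigr do rewrite mulr_sumr.
rewrite (exchange_big_dep xpredT)//= mulr_suml -sumrB; apply: eq_bigr => i _.
rewrite -mulr_suml sum_level_weights ?leq_ord// mul2n -addnn exprD.
by field; rewrite !sX_neq0.
Qed.

Lemma sum_level_weights_sqr :
  \sum_(l < p) (s%:R - 1) / s%:R ^+ l.+1 * (A0 s omega - A0l s omega l) ^+ 2 =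
  A0 s omega ^+ 2 * (1 + (s%:R ^+ p)^-1) - 2 * A0 s omega * A1 s omega +
  \sum_(l < p) (s%:R - 1) / s%:R ^+ l.+1 * A0l s omega l ^+ 2.
Proof.
pose wt l : R := (s%:R - 1) / s%:R ^+ l.+1.
transitivity (A0 s omega ^+ 2 * (\sum_(l < p) wt l)
    - 2 * A0 s omega * (\sum_(l < p) wt l * A0l s omega l)
    + \sum_(l < p) wt l * A0l s omega l ^+ 2).
  rewrite [X in _ = X - _ + _]mulr_sumr [X in _ = _ - X + _]mulr_sumr.
  rewrite -sumrB -big_split; apply: eq_bigr => l _ /=.
  by rewrite -/(wt l); ring.
have := sum_level_weights (leq0n p); rewrite /= expr0 invr1 => ->.
by rewrite sum_level_weights_A0l; ring.
Qed.

End Constants.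

(** * Distances, discrepancy and projection criterion of a design *)

Section Design.
Variables (R : realType) (s p m n : nat) (omega : 'I_p.+1 -> R).
Hypotheses (s_gt1 : (1 < s)%N) (n_gt0 : (0 < n)%N).
Variable D : 'M['I_(s ^ p)]_(n, m).

Notation A0 := (A0 s omega).
Notation A1 := (A1 s omega).
Notation prox := (proximity omega).

Let s_gt0 : (0 < s)%N. Proof. exact: ltnW. Qed.

Lemma distE (a b : 'I_n) :
  dist omega D a b = \sum_(k < m) (A0 - prox (D a k) (D b k)).
Proof.
by apply: eq_bigr => k _; rewrite !tnth_mktuple dist_coordE.
Qed.

Lemma dist_diag (a : 'I_n) : dist omega D a a = 0.
Proof.
rewrite distE big1// => k _; apply/eqP; rewrite subr_eq0; apply/eqP.
by apply: eq_bigr => i _; rewrite /delta eqxx mulr1.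
Qed.

Lemma dist_sym (a b : 'I_n) : dist omega D a b = dist omega D b a.
Proof.
apply: eq_bigr => k _; apply: eq_bigr => i _.
by rewrite /delta eq_sym.
Qed.

Lemma SD2_subdesign (u : {set 'I_m}) :
  SD2 s omega (design_pts R (subdesign D u)) =
  (\sum_(a < n) \sum_(b < n) \prod_(k in u) prox (D a k) (D b k)) / n%:R ^+ 2
  - A1 ^+ #|u|.
Proof.
rewrite SD2E//; last first.
  (* Level points lie in the unit interval since [2x + 1 < 2 s^p]. *)
  move=> a j; rewrite tnth_mktuple /level_pt divr_ge0//=.
  have sp0 : (0 < s ^ p)%N by rewrite expn_gt0 s_gt0.
  rewrite ltr_pdivrMr ?ltr0n ?muln_gt0// mul1r ltr_nat.
  by case: (subdesign D u a j) => x /=; move: (s ^ p)%N sp0 => q _; lia.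
congr (_ / _ - _); apply: eq_bigr => a _; apply: eq_bigr => b _.
rewrite [RHS]big_enum_val; apply: eq_bigr => j _.
by apply: eq_bigr => i _; rewrite !tnth_mktuple !mxE.
Qed.

Section Utype.
Hypothesis UD : U_type D.

(** The [s^p] level counts of a column are equal and add up to [n]. *)
Lemma U_type_balanced (k : 'I_m) (y : 'I_(s ^ p)) :
  (#|[pred b | D b k == y]| * s ^ p)%N = n.
Proof.
rewrite -[RHS]card_ord -[RHS]sum1_card (partition_big (D^~ k) predT)//=.
transitivity (\sum_(z < s ^ p) #|[pred b | D b k == y]|)%N.
  by rewrite sum_nat_const card_ord mulnC.
by apply: eq_bigr => z _; rewrite (UD k y z) -sum1_card.
Qed.

Lemma sum_dist (a : 'I_n) :
  \sum_(b < n) dist omega D a b = n%:R * m%:R * (A0 - A1).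
Proof.
under eq_bigr do rewrite distE.
rewrite exchange_big/=.
transitivity (\sum_(k < m) (n%:R * A0 - n%:R * A1)).
  apply: eq_bigr => k _; rewrite sumrB sumr_const card_ord mulr_natl.
  by rewrite (sum_proximity s_gt1 omega (U_type_balanced k)).
by rewrite sumr_const card_ord -mulr_natl; ring.
Qed.

(** [n] is a positive multiple of [s^p >= 2]; this makes the denominators [n - 1] nonzero. *)
Lemma U_type_n_gt1 : (1 <= p)%N -> (0 < m)%N -> (1 < n)%N.
Proof.
move=> p1 m0; have sp : (1 < s ^ p)%N.
  by rewrite -[1%N]/(s ^ 0)%N ltn_exp2l.
have := U_type_balanced (Ordinal m0) (Ordinal (ltnW sp)).
by case: #|_| => [|c] E; move: n_gt0; rewrite -E ?mul0n// mulSn; lia.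
Qed.

(** [dbar] is the mean of the [n - 1] off-diagonal entries of each row, so this is the variance
    identity row by row; the terms [(n - 1) * dbar^2] add up to [G_LB]. *)
Lemma G_defect : (1 < n)%N ->
  G omega D = G_LB s omega n m +
    \sum_(a < n) \sum_(b < n | b != a)
      (dist omega D a b - dbar s omega n m) ^+ 2.
Proof.
move=> n1; have n1R : n%:R - 1 != 0 :> R.
  by rewrite subr_eq0 pnatr_eq1 gtn_eqF.
set db := dbar _ _ _ _.
have step (a : 'I_n) : \sum_(b < n | b != a) (dist omega D a b - db) ^+ 2 =
    \sum_(b < n) dist omega D a b ^+ 2
    - n%:R / (n%:R - 1) * n%:R * m%:R ^+ 2 * (A0 - A1) ^+ 2.
  (* As [dist omega D a a = 0], the diagonal term is [db ^+ 2]. *)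
  transitivity (\sum_(b < n) (dist omega D a b - db) ^+ 2 - db ^+ 2).
    by rewrite [in RHS](bigD1 a)//= dist_diag sub0r sqrrN addrAC subrr add0r.
  transitivity (\sum_(b < n) dist omega D a b ^+ 2
      - 2 * db * (\sum_(b < n) dist omega D a b) + (n%:R - 1) * db ^+ 2).
    rewrite mulrBl mul1r addrA; congr (_ - _).
    transitivity (\sum_(b < n)
        (dist omega D a b ^+ 2 - 2 * db * dist omega D a b + db ^+ 2)).
      by apply: eq_bigr => b _; ring.
    by rewrite big_split sumrB/= -mulr_sumr sumr_const card_ord
      -[db ^+ 2 *+ n]mulr_natl.
  by rewrite sum_dist /db /dbar; field.
under eq_bigr do rewrite step.
rewrite sumrB sumr_const card_ord /G_LB -(mulr_natl (_ / _ * _ * _ * _)) addrCA.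
rewrite -[LHS]addr0; congr (_ + _).
by apply/esym/eqP; rewrite subr_eq0; apply/eqP; field.
Qed.

Lemma G_le_UB : G omega D <= G_UB s omega n m.
Proof.
apply: (@le_trans _ _ (\sum_(a < n) \sum_(b < n)
    (m%:R * \sum_(k < m) (A0 - prox (D a k) (D b k)) ^+ 2))).
  by apply: ler_sum => a _; apply: ler_sum => b _; rewrite distE sqr_sum_le.
under eq_bigr do rewrite -mulr_sumr exchange_big.
rewrite -mulr_sumr exchange_big/=.
under eq_bigr do rewrite (sum_dist_coord_sqr s_gt1 omega (U_type_balanced _)).
rewrite sumr_const card_ord -mulr_natl /G_UB.
by rewrite le_eqVlt; apply/orP; left; apply/eqP; ring.
Qed.

(** The kernels of the columns add up to [m * A0 - d_ab], so the sum over pairs of columns is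
    quadratic in [d_ab]. The squares give [G]; the linear terms and the squared kernels have sums
    fixed by balance. *)
Lemma PhiSDE : (1 < m)%N ->
  PhiSD omega D =
  G omega D / (n%:R ^+ 2 * m%:R * (m%:R - 1))
  + m%:R / (m%:R - 1) * (2 * A0 * A1 - A0 ^+ 2)
  - A1 ^+ 2 - (B s omega + 2 * C s omega) / (m%:R - 1).
Proof.
move=> m1; have m1R : m%:R - 1 != 0 :> R.
  by rewrite subr_eq0 pnatr_eq1 gtn_eqF.
have m0R : m%:R != 0 :> R by rewrite pnatr_eq0 -lt0n ltnW.
have n0R : n%:R != 0 :> R by rewrite pnatr_eq0 -lt0n.
(* The constant family [A1] in [sum_pairs_prod] counts the pairs. *)
have pairsA1 : 2 * \sum_(u : {set 'I_m} | #|u| == 2%N) A1 ^+ #|u| =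
    m%:R * (m%:R - 1) * A1 ^+ 2.
  have := sum_pairs_prod (fun _ : 'I_m => A1).
  under eq_bigr do rewrite prodr_const.
  move=> ->; rewrite !sumr_const card_ord -(mulr_natl A1).
  by rewrite -(mulr_natl (A1 ^+ 2)); ring.
have pairsK : 2 * \sum_(u : {set 'I_m} | #|u| == 2%N)
      \sum_(a < n) \sum_(b < n) \prod_(k in u) prox (D a k) (D b k) =
    G omega D + n%:R ^+ 2 * m%:R ^+ 2 * (2 * A0 * A1 - A0 ^+ 2)
    - n%:R ^+ 2 * m%:R * (B s omega + 2 * C s omega).
  rewrite exchange_big/=.
  under eq_bigr do rewrite exchange_big/=.
  rewrite mulr_sumr; under eq_bigr do rewrite mulr_sumr.
  transitivity (\sum_(a < n) \sum_(b < n)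
     (dist omega D a b ^+ 2 - 2 * m%:R * A0 * dist omega D a b
      + m%:R ^+ 2 * A0 ^+ 2
      - \sum_(k < m) prox (D a k) (D b k) ^+ 2)).
    apply: eq_bigr => a _; apply: eq_bigr => b _.
    rewrite sum_pairs_prod; congr (_ - _).
    rewrite distE sumrB sumr_const card_ord -(mulr_natl A0); ring.
  have -> : n%:R ^+ 2 * m%:R * (B s omega + 2 * C s omega) =
      \sum_(a < n) \sum_(b < n) \sum_(k < m) prox (D a k) (D b k) ^+ 2.
    under [RHS]eq_bigr do rewrite exchange_big.
    rewrite exchange_big/=.
    under [RHS]eq_bigr do
      rewrite (sum_proximity_sqr s_gt1 omega (U_type_balanced _)).
    by rewrite sumr_const card_ord -(mulr_natl (_ * _)); ring.
  under eq_bigr do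
    rewrite sumrB big_split sumrB/= -mulr_sumr sum_dist sumr_const card_ord.
  rewrite sumrB big_split sumrB/= !sumr_const !card_ord -/(G omega D).
  rewrite -(mulr_natl (_ * _ * _ * _)) -(mulr_natl (_ *+ n)).
  by rewrite -(mulr_natl (_ ^+ 2 * _)); ring.
rewrite /PhiSD; under eq_bigr do rewrite SD2_subdesign.
rewrite sumrB -mulr_suml.
set X := \sum_(u | _) _ in pairsK *; set Y := \sum_(u | _) _ in pairsA1 *.
transitivity ((2 * X) / (n%:R ^+ 2 * m%:R * (m%:R - 1))
              - (2 * Y) / (m%:R * (m%:R - 1))).
  by field; rewrite m1R m0R n0R.
by rewrite pairsK pairsA1; field; rewrite m1R m0R n0R.
Qed.

End Utype.
End Design.

(** * The bounds and their attainment *)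

Theorem theorem2 (R : realType) (s p m n : nat) (omega : 'I_p.+1 -> R)
    (hs : (2 <= s)%N) (hp : (1 <= p)%N) (hm : (2 <= m)%N) (hn : (0 < n)%N)
    (omega_ge0 : forall i, 0 <= omega i) (omega_pos : exists i, 0 < omega i)
    (D : 'M['I_(s ^ p)]_(n, m)) (hD : U_type D) :
  (G_LB s omega n m <= G omega D <= G_UB s omega n m) /\
  (G omega D = G_LB s omega n m <->
     forall a b : 'I_n, (a < b)%N -> dist omega D a b = dbar s omega n m) /\
  (forall E : 'M['I_(s ^ p)]_(n, m), U_type E ->
     (exists2 c : 'cV['I_(s ^ p)]_n,
        balanced c & forall k : 'I_m, col k E = c) ->
     G omega E = G_UB s omega n m) /\
  (Phi_LB s omega n m <= PhiSD omega D <= Phi_UB s omega m).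
Proof.
have n1 : (1 < n)%N := U_type_n_gt1 hs hn hD hp (ltnW hm).
have GD := G_defect omega hs hD n1.
have defect_ge0 (a b : 'I_n) : b != a ->
    0 <= (dist omega D a b - dbar s omega n m) ^+ 2.
  by move=> _; exact: sqr_ge0.
have LB : G_LB s omega n m <= G omega D.
  rewrite GD lerDl; apply: sumr_ge0 => a _.
  by apply: sumr_ge0 => b; exact: defect_ge0.
have UB : G omega D <= G_UB s omega n m := G_le_UB omega hs hD.
split; first by rewrite LB UB.
split.
  split=> [/eqP|dE].
    (* Equality makes the defect zero; being a sum of squares, it vanishes term by term. *)
    rewrite GD -subr_eq0 addrAC subrr add0r psumr_eq0; last first.
      by move=> a _; apply: sumr_ge0 => b; exact: defect_ge0.
    move=> /allP H a b ab; have := H a (mem_index_enum a).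
    rewrite /= psumr_eq0; last first.
      by move=> c; exact: defect_ge0.
    move=> /allP /(_ b (mem_index_enum b)) /implyP.
    rewrite -val_eqE gtn_eqF//= => /(_ isT).
    by rewrite sqrf_eq0 subr_eq0 => /eqP.
  rewrite GD big1 ?addr0// => a _; rewrite big1// => b.
  (* The hypothesis covers [a < b]; symmetry of the distance covers [b < a]. *)
  rewrite neq_ltn => /orP[ba|ab]; last by rewrite dE// subrr expr0n.
  by rewrite dist_sym dE// subrr expr0n.
split.
  move=> E UE [c _ Ec].
  have Ek (a : 'I_n) k : E a k = c a ord0 by rewrite -(Ec k) mxE.
  pose k0 : 'I_m := Ordinal (ltnW hm).
  have bal := U_type_balanced UE k0.
  (* With identical columns, each distance is [m] times that of column [k0]. *)
  transitivity (m%:R ^+ 2 * \sum_(a < n) \sum_(b < n)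
      (A0 s omega - proximity omega (E a k0) (E b k0)) ^+ 2).
    rewrite mulr_sumr; apply: eq_bigr => a _.
    rewrite mulr_sumr; apply: eq_bigr => b _.
    under [dist _ _ _ _]eq_bigr do rewrite !tnth_mktuple dist_coordE !Ek.
    by rewrite sumr_const card_ord -(mulr_natl (_ - _)) exprMn !Ek.
  by rewrite (sum_dist_coord_sqr hs omega bal) /G_UB; ring.
have m1R : 0 < m%:R - 1 :> R by rewrite subr_gt0 ltr1n.
have n1R : 0 < n%:R - 1 :> R by rewrite subr_gt0 ltr1n.
have m0R : 0 < m%:R :> R by rewrite ltr0n ltnW.
have n0R : 0 < n%:R :> R by rewrite ltr0n.
have den : 0 < (n%:R ^+ 2 * m%:R * (m%:R - 1))^-1 :> R.
  by rewrite invr_gt0 !mulr_gt0// exprn_gt0.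
(* [Phi_LB] and [Phi_UB] are the images of [G_LB] and [G_UB] under the affine map of [PhiSDE], whose
   slope is positive by [den]. *)
have -> : Phi_LB s omega n m =
    G_LB s omega n m / (n%:R ^+ 2 * m%:R * (m%:R - 1))
    + m%:R / (m%:R - 1) * (2 * A0 s omega * A1 s omega - A0 s omega ^+ 2)
    - A1 s omega ^+ 2 - (B s omega + 2 * C s omega) / (m%:R - 1).
  by rewrite /Phi_LB /G_LB; field; rewrite !gt_eqF.
have -> : Phi_UB s omega m =
    G_UB s omega n m / (n%:R ^+ 2 * m%:R * (m%:R - 1))
    + m%:R / (m%:R - 1) * (2 * A0 s omega * A1 s omega - A0 s omega ^+ 2)
    - A1 s omega ^+ 2 - (B s omega + 2 * C s omega) / (m%:R - 1).
  rewrite /Phi_UB /G_UB sum_level_weights_sqr ?(ltnW hs)//.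
  set W := \sum_(l < p) _.
  by field; rewrite !gt_eqF// ?exprn_gt0// ltr0n ltnW.
by rewrite (PhiSDE omega hs hn hD hm) !lerD2r !ler_pM2r// LB UB.
Qed.
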